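(* Let $G$ be a hyperbolic group. The intersection of any nonempty family (finite or infinite) of subsets of $G$, each of which is a finite union of ME-products in $G$, is itself a finite union of ME-products in $G$.
   Context: A group is elementary if it has a cyclic subgroup of finite index; a maximal elementary subgroup of $G$ is an elementary subgroup not properly contained in another elementary subgroup. An ME-product in $G$ is a set of the form $f_1G_1f_2G_2\cdots f_nG_n=\{f_1g_1\cdots f_ng_n\mid g_i\in G_i\}$, where $n\in\mathbb{N}\cup\{0\}$, $G_1,\dots,G_n$ are infinite maximal elementary subgroups of $G$ and $f_1,\dots,f_n\in G$; by convention, for $n=0$ this is the empty set. In addition, every element $g\in G$ (i.e. every singleton $\{g\}$) is also considered to be an ME-product. *)

(* Defs.v *)
From HB Require Import structures.
From mathcomp Require Import all_boot all_order all_algebra.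
From mathcomp Require Import mathcomp_extra boolp classical_sets functions.
From mathcomp Require Import cardinality.

Set Implicit Arguments.
Unset Strict Implicit.
Unset Printing Implicit Defensive.

Import Order.TTheory GRing.Theory Num.Theory.

Local Open Scope classical_set_scope.
Local Open Scope group_scope.

Section WordMetric.
Variables (G : groupType) (A : seq G).

Definition has_word (g : G) : pred nat := fun n =>
  `[< exists w : seq G,
      [/\ all [in A ++ [seq a^-1 | a <- A]] w, size w = n
        & \prod_(a <- w) a = g] >].

Definition generates : Prop := forall g : G, exists n : nat, has_word g n.

Definition word_length (genA : generates) (g : G) : nat := ex_minn (genA g).

Definition word_dist (genA : generates) (x y : G) : nat :=
  word_length genA (x^-1 * y).

End WordMetric.

Section GromovHyperbolicity.
Variables (T : Type) (d : T -> T -> nat).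
Local Open Scope ring_scope.

Definition gromov_product (w x y : T) : rat :=
  ((d x w)%:R + (d y w)%:R - (d x y)%:R) / 2%:R.

Definition gromov_hyperbolic : Prop :=
  exists delta : rat, forall w x y z : T,
    Num.min (gromov_product w x y) (gromov_product w y z) - delta
      <= gromov_product w x z.

End GromovHyperbolicity.

(* Hyperbolicity of the word metric does not depend on the choice of the finite
   generating set. *)
Definition hyperbolic_group (G : groupType) : Prop :=
  exists (A : seq G) (genA : generates A), gromov_hyperbolic (word_dist genA).

Section Elementary.
Variable G : groupType.
Implicit Types (H K : set G) (c : G).

Definition subgroup H : Prop := group_closed (mem H).

Definition cyclic_subgroup c : set G :=
  [set x | exists n : nat, x = c ^+ n \/ x = c ^- n].

Definition left_cosets K H : set (set G) :=
  [set [set x * k | k in K] | x in H].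

Definition finite_index K H : Prop := finite_set (left_cosets K H).

Definition elementary H : Prop :=
  subgroup H /\
  exists c, cyclic_subgroup c `<=` H /\ finite_index (cyclic_subgroup c) H.

Definition maximal_elementary H : Prop :=
  elementary H /\ forall K, elementary K -> H `<=` K -> K = H.

End Elementary.

Section MEProducts.
Variable G : groupType.

(* The empty sequence of factors yields the empty set, not [set 1]. *)
Definition ME_product_set n (f : 'I_n -> G) (H : 'I_n -> set G) : set G :=
  if n == 0%N then set0 else
  [set \prod_(i < n) (f i * g i) | g in [set g : 'I_n -> G | forall i, H i (g i)]].

Definition ME_product (P : set G) : Prop :=
  (exists n (f : 'I_n -> G) (H : 'I_n -> set G),
     (forall i, maximal_elementary (H i) /\ infinite_set (H i)) /\
     P = ME_product_set f H)
  \/ (exists g : G, P = [set g]).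

Definition finite_union_ME_products (S : set G) : Prop :=
  exists F : set (set G),
    [/\ finite_set F, forall P, F P -> ME_product P & S = \bigcup_(P in F) P].

End MEProducts.

(* Main.v *)
(** Write a product as e H_1 g_1 H_2 g_2 ... H_n g_n, and call it reduced when
    H_i <> g_i H_(i+1) g_i^-1 for all i; otherwise H_(i+1) can be absorbed into
    H_i.  Distinct infinite maximal elementary subgroups H, K diverge: the Gromov
    products (h | k)_1 with h in H, k in K are bounded, since two quasi-axes that
    fellow-travel for long have a common power, and all elements commensurating
    that power lie in one elementary subgroup.  Hence, in a reduced product, factors
    h_i that are all long form a local quasi-geodesic, and so two reduced products
    P, Q sharing an element with long factors in both must start along the same
    coset; peeling it off and inducting on the number of factors gives P contained
    in Q.  Elements of P with some short factor h_i form a finite union of products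
    with fewer factors.  By induction the intersection of P and Q is therefore either
    P or a finite union of products with fewer factors than P, so that intersecting P
    successively with members of a family stops after finitely many steps. *)

Require Import Defs.
From mathcomp Require Import all_boot all_order all_algebra zify lra.
From mathcomp Require Import boolp classical_sets cardinality.

Set Implicit Arguments.
Unset Strict Implicit.
Unset Printing Implicit Defensive.

Import Order.TTheory GRing.Theory Num.Theory.

Local Open Scope classical_set_scope.
Local Open Scope group_scope.

Ltac gsimp :=
  rewrite ?(mulgA, mulgK, mulgVK, mulVg, mulgV, mul1g, mulg1, invgM, invgK, invg1).

(** * Word length in a hyperbolic group as an integer-valued norm *)

Record hyperbolic_norm (G : groupType) (len : G -> nat) (D : nat) : Prop := {
  hn_len1 : len 1 = 0%N;
  hn_lenM : forall x y, (len (x * y)%g <= len x + len y)%N;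
  hn_lenV : forall x, len x^-1 = len x;
  hn_ball : forall r, exists s : seq G, forall x, (len x <= r)%N -> x \in s;
  hn_geodesic : forall x i, (i <= len x)%N ->
    exists2 m, len m = i & len (m^-1 * x) = (len x - i)%N;
  (* Gromov's inequality with all products doubled, so that [D >= 2 * delta]. *)
  hn_four_point : forall x y z w,
    (len (x^-1 * z)%g + len (y^-1 * w)%g
       <= len (x^-1 * y)%g + len (z^-1 * w)%g + D)%N
    \/ (len (x^-1 * z)%g + len (y^-1 * w)%g
       <= len (y^-1 * z)%g + len (x^-1 * w)%g + D)%N }.

Section WordNorm.
Variables (G : groupType) (A : seq G) (genA : generates A).
Let l := word_length genA.

Lemma word_length_has_word g : has_word A g (l g).
Proof. by rewrite /l /word_length; case: ex_minnP. Qed.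

Lemma word_length_le g w :
  all [in A ++ [seq a^-1 | a <- A]] w -> \prod_(a <- w) a = g -> (l g <= size w)%N.
Proof.
move=> wA wg; rewrite /l /word_length; case: ex_minnP => n _; apply.
by apply/asboolP; exists w.
Qed.

Lemma word_lengthP g : exists w, [/\ all [in A ++ [seq a^-1 | a <- A]] w,
  size w = l g & \prod_(a <- w) a = g].
Proof. by have /asboolP := word_length_has_word g. Qed.

Lemma word_length1 : l 1 = 0%N.
Proof.
by apply/eqP; rewrite -leqn0; apply: (@word_length_le _ [::]); rewrite ?big_nil.
Qed.

Lemma word_length_eq0 g : l g = 0%N -> g = 1.
Proof.
by have [w [_ <- <-]] := word_lengthP g => /size0nil ->; rewrite big_nil.
Qed.

Lemma word_lengthM g h : (l (g * h)%g <= l g + l h)%N.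
Proof.
have [w [wA <- wg]] := word_lengthP g; have [v [vA <- vh]] := word_lengthP h.
by rewrite -size_cat; apply: word_length_le; rewrite ?all_cat ?wA // big_cat wg vh.
Qed.

Lemma word_lengthV_le g : (l g^-1%g <= l g)%N.
Proof.
have [w [wA <- wg]] := word_lengthP g.
rewrite -(size_map (fun a : G => a^-1)) -size_rev; apply: word_length_le.
  apply/allP => x; rewrite mem_rev => /mapP[y yw ->].
  have /(_ y yw) := allP wA; rewrite /= !mem_cat => /orP[yA|/mapP[z zA ->]].
    by rewrite (map_f (fun a : G => a^-1) yA) orbT.
  by rewrite invgK zA.
by rewrite -wg -map_rev big_map prodgV revK.
Qed.

Lemma word_lengthV g : l g^-1 = l g.
Proof.
by apply/eqP; rewrite eqn_leq word_lengthV_le -{1}(invgK g) word_lengthV_le.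
Qed.

Lemma word_ball r : exists s : seq G, forall x, (l x <= r)%N -> x \in s.
Proof.
elim: r => [|r [s sP]].
  by exists [:: 1] => x; rewrite leqn0 => /eqP/word_length_eq0 ->; rewrite inE.
exists (s ++ [seq a * x | a <- A ++ [seq a^-1 | a <- A], x <- s]) => x.
rewrite mem_cat; have [w [+ sw wx]] := word_lengthP x.
case: w sw wx => [|a w] /= sw.
  by rewrite big_nil => <- _; rewrite sP ?word_length1.
rewrite big_cons => wx /andP[aA wA] lr; rewrite -wx; apply/orP; right.
apply: allpairs_f => //; apply: sP.
by apply: leq_trans (word_length_le wA erefl) _; rewrite -ltnS; move: sw lr => /= ->.
Qed.

(** Cut a shortest word for [x] after [i] letters: the pieces have length at most [i] and [l x - i],
    and the triangle inequality forces equality. *)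
Lemma word_geodesic x i : (i <= l x)%N ->
  exists2 m, l m = i & l (m^-1 * x) = (l x - i)%N.
Proof.
have [w [wA sw wx]] := word_lengthP x => ile.
move: wA; rewrite -(cat_take_drop i w) all_cat => /andP[w1 w2].
have := word_length_le w1 erefl; have := word_length_le w2 erefl.
set m := \prod_(a <- take i w) a; set m' := \prod_(a <- drop i w) a.
have xE : x = m * m' by rewrite -wx -{1}(cat_take_drop i w) big_cat.
rewrite size_drop size_takel ?sw // => h1 h2.
have := word_lengthM m m'; rewrite -xE => h3.
by exists m; rewrite ?xE ?mulKg -?xE; lia.
Qed.

End WordNorm.

Lemma hyperbolic_group_norm (G : groupType) : hyperbolic_group G ->
  exists (len : G -> nat) D, hyperbolic_norm len D.
Proof.
move=> [A [genA [delta hyp]]].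
pose D := Num.bound `|2%:R * delta|%R.
have dD : (2%:R * delta < D%:R)%R.
  by apply: le_lt_trans (ler_norm _) _; apply: archi_boundP.
exists (word_length genA), D; split.
- exact: word_length1.
- exact: word_lengthM.
- exact: word_lengthV.
- exact: word_ball.
- exact: word_geodesic.
move=> x y z w; have := hyp w x y z.
rewrite -!(ler_nat rat) !natrD /gromov_product /word_dist.
by rewrite minEle; case: ifP => _ h; [left|right]; lra.
Qed.

(** * Pigeonhole principle and exponential growth *)

Lemma seq_collision (T : eqType) (s : seq T) (f : nat -> T) :
  (forall i, (i <= size s)%N -> f i \in s) ->
  exists i j, [/\ (i < j)%N, (j <= size s)%N & f i = f j].
Proof.
move=> fs; pose t := [seq f i | i <- iota 0 (size s).+1].
have : ~~ uniq t.
  apply/negP => ut; have ts : {subset t <= s}.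
    by move=> x /mapP[i + ->]; rewrite mem_iota => ?; apply: fs; lia.
  by have := uniq_leq_size ut ts; rewrite size_map size_iota ltnn.
move=> /(uniqPn (f 0%N))[i [j [ij]]]; rewrite size_map size_iota => jt.
rewrite !(nth_map 0%N) ?size_iota ?nth_iota //; try lia.
by move=> e; exists i, j; split; rewrite -1?ltnS.
Qed.

Lemma exp2_gt_linear a b : exists k, (a + k * b < 2 ^ k)%N.
Proof.
pose l := (a + 2 * b + 1)%N; exists (2 * l)%N.
have lt := ltn_expl l (isT : 1 < 2)%N.
rewrite mul2n -addnn expnD.
apply: leq_ltn_trans (_ : _ <= l * l)%N (ltn_mul lt lt).
by rewrite /l; nia.
Qed.

(** * Subgroups and commensurators *)

Definition infinite_order (G : groupType) (x : G) :=
  forall n, (0 < n)%N -> x ^+ n <> 1.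

Lemma infinite_order_inj (G : groupType) (x : G) i j : infinite_order x -> x ^+ i = x ^+ j -> i = j.
Proof.
move=> xoo; wlog ij : i j / (i <= j)%N.
  by move=> h e; case: (leqP i j) => [/h|/ltnW/h] ->.
rewrite -(subnKC ij) expgnDr -[LHS]mulg1 => /mulgI /esym.
by case: (posnP (j - i)) => [->|/xoo //]; rewrite addn0.
Qed.

Lemma seq_uniform_bound (T : eqType) (s : seq T) (P : T -> nat -> Prop) :
  (forall x m n, (m <= n)%N -> P x m -> P x n) ->
  (forall x, x \in s -> exists n, P x n) ->
  exists n, forall x, x \in s -> P x n.
Proof.
move=> mono; elim: s => [|a s ih] h; first by exists 0%N.
have [|n hn] := ih; first by move=> x xs; apply: h; rewrite inE xs orbT.
have [m hm] := h a (mem_head a s).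
exists (maxn n m) => x; rewrite inE => /orP[/eqP ->|/hn].
  exact: mono (leq_maxr _ _) hm.
exact/mono/leq_maxl.
Qed.

Section Subgroups.
Variables (G : groupType) (H : set G).
Hypothesis gH : subgroup H.
Implicit Types x y : G.

Lemma subgroup1 : H 1.
Proof. by case: gH => h _; move: h; rewrite inE. Qed.

Lemma subgroupV x : H x -> H x^-1.
Proof.
by case: gH => h1 h xH; have := h 1 x h1; rewrite !inE /= div1g => /(_ xH).
Qed.

Lemma subgroupM x y : H x -> H y -> H (x * y).
Proof.
case: gH => h1 h xH /subgroupV yH; have := h x y^-1.
by rewrite !inE /= invgK; apply.
Qed.

Lemma subgroupX x n : H x -> H (x ^+ n).
Proof.
by move=> xH; elim: n => [|n ih]; [exact: subgroup1|rewrite expgS; apply: subgroupM].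
Qed.

End Subgroups.

Lemma group_set_subgroup (G : groupType) (H : set G) :
  H 1 -> (forall x y, H x -> H y -> H (x * y)) -> (forall x, H x -> H x^-1) ->
  subgroup H.
Proof.
move=> h1 hM hV; split; first by rewrite inE.
by move=> x y; rewrite !inE /= => xH /hV; apply: hM.
Qed.

Section Cyclic.
Variables (G : groupType) (c : G).

Lemma cyclic_subgroup_exp n : cyclic_subgroup c (c ^+ n).
Proof. by exists n; left. Qed.

Lemma cyclic_subgroupP x : cyclic_subgroup c x <->
  exists m n, x = (c ^+ m)^-1 * c ^+ n.
Proof.
split=> [[n [->|->]]|[m [n ->]]].
- by exists 0%N, n; rewrite invg1 mul1g.
- by exists n, 0%N; rewrite mulg1.
case: (leqP m n) => mn.
  by exists (n - m)%N; left; rewrite -{1}(subnKC mn) expgnDr mulKg.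
exists (m - n)%N; right.
by rewrite -{1}(subnKC (ltnW mn)) expgnDr invgM mulgVK.
Qed.

Lemma cyclic_subgroup_subgroup : subgroup (cyclic_subgroup c).
Proof.
apply: group_set_subgroup => [|x y|x].
- exact: cyclic_subgroup_exp 0%N.
- move=> /cyclic_subgroupP[m [n ->]] /cyclic_subgroupP[k [l ->]].
  apply/cyclic_subgroupP; exists (k + m)%N, (n + l)%N.
  have nk : c ^+ n * c ^- k = c ^- k * c ^+ n.
    exact/commuteV/commuteX2/commute_refl.
  by rewrite !expgnDr invgM -!mulgA (mulgA (c ^+ n)) nk !mulgA.
- by case=> n [->|->]; exists n; [right|left]; rewrite ?invgK.
Qed.

Lemma cyclic_subgroup_finite n : (0 < n)%N -> c ^+ n = 1 ->
  finite_set (cyclic_subgroup c).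
Proof.
move=> n0 cn1; have modE m : c ^+ m = c ^+ (m %% n).
  by rewrite {1}(divn_eq m n) expgnDr mulnC expgnA cn1 expg1n mul1g.
pose s := [seq c ^+ i | i <- iota 0 n].
apply: (@sub_finite_set _ _ [set` s ++ [seq a^-1 | a <- s]]); last exact: finite_seq.
have sP m : c ^+ m \in s by rewrite modE map_f // mem_iota ltn_mod.
move=> x [m [->|->]] /=; rewrite mem_cat ?sP //.
by rewrite (map_f (fun a : G => a^-1)) ?sP ?orbT.
Qed.

End Cyclic.

Lemma left_coset_eq (G : groupType) (H : set G) (gH : subgroup H) (x y : G) :
  [set x * k | k in H] = [set y * k | k in H] <-> H (x^-1 * y).
Proof.
split=> [e|xy].
  have : [set y * k | k in H] y by exists 1; [exact: subgroup1|rewrite mulg1].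
  by rewrite -e => -[k kH <-]; rewrite mulKg.
apply/seteqP; split=> _ [k kH <-].
  exists (y^-1 * x * k); last by gsimp.
  apply: subgroupM => //.
  by have := subgroupV gH xy; rewrite invgM invgK.
by exists (x^-1 * y * k); [exact: subgroupM|gsimp].
Qed.

Lemma left_coset_self (G : groupType) (H : set G) (gH : subgroup H) (x : G) :
  [set x * k | k in H] x.
Proof. by exists 1; [exact: subgroup1|rewrite mulg1]. Qed.

(** Only finitely many cosets of [K] are available for the elements [x ^+ i * u]; two that fall in
    the same coset differ by a conjugated power of [x]. *)
Lemma finite_index_return (G : groupType) (H K : set G) (x u : G) :
  subgroup K -> subgroup H -> finite_index K H -> H x -> H u ->
  exists2 a, (0 < a)%N & K ((x ^+ a) ^ u).
Proof.
move=> gK gH /finite_seqP[s sE] xH uH.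
have [|i [j [ij _ /(left_coset_eq gK) e]]] :=
  @seq_collision _ s (fun i => [set x ^+ i * u * k | k in K]).
  move=> i _; have : left_cosets K H [set x ^+ i * u * k | k in K].
    by exists (x ^+ i * u) => //; apply: subgroupM => //; apply: subgroupX.
  by rewrite sE.
exists (j - i)%N; first by rewrite subn_gt0.
move: e; rewrite -(subnKC (ltnW ij)) addKn expgnDr conjgE.
by gsimp.
Qed.

(** This is the commensurator of the cyclic subgroup generated by [x]. Exponents are positive
    naturals, with the sign carried by the disjunction. *)
Definition commensurator (G : groupType) (x : G) : set G :=
  [set u | exists a b, [/\ (0 < a)%N, (0 < b)%N &
     (x ^+ a) ^ u = x ^+ b \/ (x ^+ a) ^ u = x ^- b]].

Lemma commensurator_subgroup (G : groupType) (x : G) : subgroup (commensurator x).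
Proof.
apply: group_set_subgroup => [|u v|u].
- by exists 1%N, 1%N; split=> //; left; rewrite conjg1.
- move=> [a [b [a0 b0 hu]]] [c [d [c0 d0 hv]]].
  exists (a * c)%N, (d * b)%N; rewrite !muln_gt0 a0 b0 c0 d0; split=> //.
  rewrite conjgM expgnA conjXg.
  case: hu => ->; rewrite ?expVgn -expgnA mulnC expgnA ?conjVg conjXg;
    case: hv => ->; rewrite ?expVgn ?invgK -expgnA; by [left|right].
- move=> [a [b [a0 b0 hu]]]; exists b, a; split=> //.
  case: hu => hu; [left|right].
    by rewrite -hu conjgK.
  by rewrite -[x ^+ b]invgK -hu conjVg conjgK.
Qed.

(** Some power of [x], conjugated by [u], and some power of [x] itself both lie in the cyclic
    subgroup of [c]. Both are nontrivial because [x] has infinite order, so further powers of them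
    agree up to sign. *)
Lemma elementary_sub_commensurator (G : groupType) (H : set G) (x : G) :
  elementary H -> H x -> infinite_order x -> H `<=` commensurator x.
Proof.
move=> [gH [c [cH fi]]] xH xoo u uH.
have gc := cyclic_subgroup_subgroup c.
have [a a0 [k hk]] := finite_index_return gc gH fi xH uH.
have [b b0 [l hl]] := finite_index_return gc gH fi xH (subgroup1 gH).
rewrite conjg1 in hl.
have k0 : (0 < k)%N.
  rewrite lt0n; apply/eqP => k0; apply: (xoo a) => //.
  by apply/eqP; rewrite -(conjg_eq1 _ u); move: hk; rewrite k0 invg1 => -[] ->.
have l0 : (0 < l)%N.
  rewrite lt0n; apply/eqP => l0; apply: (xoo b) => //.
  by move: hl; rewrite l0 invg1 => -[].
exists (a * l)%N, (b * k)%N; rewrite !muln_gt0 a0 b0 k0 l0; split=> //.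
rewrite !expgnA conjXg.
by case: hk => ->; case: hl => ->; rewrite ?expVgn ?invgK expgnAC; by [left|right].
Qed.

Lemma infinite_elementary_order (G : groupType) (H : set G) (c : G) :
  infinite_set H -> finite_index (cyclic_subgroup c) H -> infinite_order c.
Proof.
move=> Hoo fi n n0 cn1; apply: Hoo.
apply: (@sub_finite_set _ _ (\bigcup_(K in left_cosets (cyclic_subgroup c) H) K)).
  move=> h hH; exists [set h * k | k in cyclic_subgroup c]; first by exists h.
  exact/left_coset_self/cyclic_subgroup_subgroup.
apply: bigcup_finite => // _ [h _ <-].
exact/finite_image/(cyclic_subgroup_finite n0).
Qed.

(** * Conjugate subgroups and reduced lists of factors *)

Section Conjugates.
Variable G : groupType.
Implicit Types (g h x c : G) (H K : set G).

(* Since [x ^ g = g^-1 * x * g], this is the subgroup g K g^-1. *)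
Definition conj_set g K : set G := [set x | K (x ^ g)].

Lemma conj_setM g h K : conj_set g (conj_set h K) = conj_set (g * h) K.
Proof. by apply/seteqP; split=> x; rewrite /conj_set /= conjgM. Qed.

Lemma conj_set1 K : conj_set 1 K = K.
Proof. by apply/seteqP; split=> x; rewrite /conj_set /= conjg1. Qed.

Lemma conj_setK g : cancel (conj_set g) (conj_set g^-1).
Proof. by move=> K; rewrite conj_setM mulVg conj_set1. Qed.

Lemma conj_setVK g : cancel (conj_set g^-1) (conj_set g).
Proof. by move=> K; rewrite conj_setM mulgV conj_set1. Qed.

Lemma conj_set_subgroup g K : subgroup K -> subgroup (conj_set g K).
Proof.
move=> gK; apply: group_set_subgroup => [|x y|x]; rewrite /conj_set /=.
- by rewrite conj1g; apply: subgroup1.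
- by rewrite conjMg; apply: subgroupM.
- by rewrite conjVg; apply: subgroupV.
Qed.

Lemma conj_set_elementary g K : elementary K -> elementary (conj_set g K).
Proof.
move=> [gK [c [cK fi]]]; split; first exact: conj_set_subgroup.
have cE : cyclic_subgroup (c ^ g^-1) = conj_set g (cyclic_subgroup c).
  apply/seteqP; split=> x; rewrite /conj_set /cyclic_subgroup /=.
    by case=> n [->|->]; exists n; [left|right];
      rewrite ?conjVg conjXg -conjgM mulVg conjg1.
  by case=> n [] e; exists n; [left|right];
    rewrite -conjXg -?conjVg -e -conjgM mulgV conjg1.
exists (c ^ g^-1); split; first by rewrite cE => x /cK.
apply: (@sub_finite_set _ _ (conj_set g @` left_cosets (cyclic_subgroup c) K)); last first.
  exact: finite_image.
move=> _ [x xK <-]; exists [set x ^ g * k | k in cyclic_subgroup c].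
  by exists (x ^ g).
rewrite cE; apply/seteqP; split=> y; rewrite /conj_set /=.
  case=> k kc e; exists (x^-1 * y); last by rewrite mulVKg.
  by rewrite conjMg -e conjVg mulKg.
by case=> k kc <-; exists (k ^ g) => //; rewrite conjMg.
Qed.

Lemma conj_set_maximal_elementary g K :
  maximal_elementary K -> maximal_elementary (conj_set g K).
Proof.
move=> [eK mK]; split=> [|H eH KH]; first exact: conj_set_elementary.
have <- : conj_set g^-1 H = K; last by rewrite conj_setVK.
apply: mK => [|x xK]; first exact: conj_set_elementary.
by apply: KH; rewrite /conj_set /= -conjgM mulVg conjg1.
Qed.

Lemma conj_set_infinite g K : infinite_set K -> infinite_set (conj_set g K).
Proof.
move=> Koo fi; apply: Koo.
apply: (@sub_finite_set _ _ ((fun x => x ^ g) @` conj_set g K)); last exact: finite_image.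
move=> x xK; exists (x ^ g^-1); last by rewrite -conjgM mulVg conjg1.
by rewrite /conj_set /= -conjgM mulVg conjg1.
Qed.

Definition infinite_maximal_elementary K := maximal_elementary K /\ infinite_set K.

Lemma infinite_maximal_elementary_conj g K :
  infinite_maximal_elementary K -> infinite_maximal_elementary (conj_set g K).
Proof.
by case=> h1 h2; split; [exact: conj_set_maximal_elementary|exact: conj_set_infinite].
Qed.

(** Here [g] stands between [H] and the first subgroup K of [L], and H g K = H (g K g^-1) g. *)
Definition apart H g (L : seq (set G * G)) :=
  if L is (K, _) :: _ then H <> conj_set g K else True.

Lemma apart_conj w g K L : apart K g L -> apart (conj_set w K) (w * g) L.
Proof.
by case: L => // -[K2 g2] L /= KK; rewrite -(conj_setM w g) => /(can_inj (conj_setK w)).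
Qed.

Fixpoint reduced (L : seq (set G * G)) : Prop :=
  if L is (H, g) :: L' then
    [/\ infinite_maximal_elementary H, apart H g L' & reduced L']
  else True.

End Conjugates.

(** * Quasi-axes in a hyperbolic group *)

Section HyperbolicNorm.
Variables (G : groupType) (len : G -> nat) (D : nat).
Hypothesis hN : hyperbolic_norm len D.
Implicit Types x y z u : G.

Lemma len1 : len 1 = 0%N. Proof. exact: hn_len1 hN. Qed.
Lemma lenM (x y : G) : (len (x * y)%g <= len x + len y)%N.
Proof. exact: (hn_lenM hN x y). Qed.
Lemma lenV (x : G) : len x^-1 = len x. Proof. exact: (hn_lenV hN x). Qed.

(* [lia] compares atoms syntactically, whereas terms of [G] occur with several
   convertible canonical structures; abstracting their lengths identifies them. *)
Ltac len_lia :=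
  repeat match goal with H : context [len _] |- _ => revert H end;
  repeat match goal with |- context [len ?t] =>
    let n := fresh "n" in set n := len t; clearbody n end;
  intros; lia.

Local Notation dist x y := (len (x^-1 * y)%g).

Lemma distC x y : dist x y = dist y x.
Proof. by rewrite -lenV invgM invgK. Qed.

Lemma dist_tri x y z : (dist x z <= dist x y + dist y z)%N.
Proof. by rewrite -{1}(mulVKg y z) mulgA; apply: lenM. Qed.

Lemma distM u x y : dist (u * x) (u * y) = dist x y.
Proof. by rewrite invgM mulgA mulgVK. Qed.

Lemma dist1 x : dist 1 x = len x.
Proof. by rewrite invg1 mul1g. Qed.

Lemma dist_mul x u : dist x (x * u) = len u.
Proof. by rewrite mulKg. Qed.

Lemma len_exp_le x n : (len (x ^+ n) <= n * len x)%N.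
Proof.
by elim: n => [|n ih]; rewrite ?len1 // expgS; have := lenM x (x ^+ n); len_lia.
Qed.

Lemma distX x m n : dist (x ^+ m) (x ^+ (m + n)) = len (x ^+ n).
Proof. by rewrite expgnDr mulKg. Qed.

Lemma infinite_order_unbounded x r :
  infinite_order x -> exists n, (r < len (x ^+ n))%N.
Proof.
move=> xoo; apply: contrapT => /forallNP h.
have [s sP] := hn_ball hN r.
have [|i [j [ij _ /(infinite_order_inj xoo)]]] :=
  @seq_collision _ s (fun n => x ^+ n); last lia.
by move=> i _; apply: sP; rewrite leqNgt; apply/negP/h.
Qed.

(* With [m] far along a geodesic from [1] to a very long power of [x], the
   shift [len (x ^+ j * m) - len m] measures how far [x ^+ j] moves [m] and is
   additive in [j] up to [D]; a shift exceeding [D] therefore doubles forever. *)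
Lemma exists_doubling_power x B : infinite_order x ->
  exists2 j, (0 < j)%N & (len (x ^+ j) + B < len (x ^+ (2 * j)))%N.
Proof.
move=> xoo; apply: contrapT => slow.
have slow2 j : (0 < j)%N -> (len (x ^+ (2 * j)) <= len (x ^+ j) + B)%N.
  by move=> j0; rewrite leqNgt; apply/negP => ?; apply: slow; exists j.
have slowX k j : (0 < j)%N -> (len (x ^+ (2 ^ k * j)) <= len (x ^+ j) + k * B)%N.
  move=> j0; elim: k => [|k ih]; first by rewrite mul1n; len_lia.
  by have := @slow2 (2 ^ k * j)%N; rewrite mulnA -expnS; len_lia.
have [s sP] := hn_ball hN (5 * D).
have [k kP] := exp2_gt_linear (size s * len x) B.
pose J := (2 ^ k * size s)%N; pose DJ := (J * len x)%N.
have lenJ j : (j <= J)%N -> (len (x ^+ j) <= DJ)%N.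
  by move=> jJ; apply: leq_trans (len_exp_le _ _) _; rewrite leq_mul2r jJ orbT.
(* Powers of [x] with exponent up to [J] have length at most [DJ]; a point [m] at depth [i] on a
   geodesic longer than [3 * i] is far from both ends compared with [DJ]. *)
pose i := (4 * DJ + 10 * D + 1)%N.
have [N NP] := infinite_order_unbounded (3 * i) xoo.
set q := x ^+ N in NP; have [|m mi mq] := hn_geodesic hN (x := q) (i := i).
  len_lia.
have qx j : q^-1 * (x ^+ j * q) = x ^+ j.
  by rewrite /q -expgnDr addnC expgnDr mulKg.
pose a j := len (x ^+ j * m).
(* The geodesic from 1 to [q] and its translate by [x ^+ j] have ends at most [DJ] apart, so they
   run together near [m], which is moved essentially along them. *)
have near j : (j <= J)%N -> (dist m (x ^+ j * m) <= (a j - i) + (i - a j) + 4 * D)%N.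
  move=> jJ; have := lenJ j jJ; set p := x ^+ j * m; set y := x ^+ j.
  have h1 : dist 1 p = a j by rewrite dist1.
  have h2 : dist y p = i by rewrite dist_mul.
  have h3 : dist p (y * q) = (len q - i)%N by rewrite distM.
  have h4 : dist 1 y = len y by rewrite dist1.
  have h5 : dist q (y * q) = len y by rewrite qx.
  have h6 : dist y (y * q) = len q by rewrite dist_mul.
  have h7 : dist 1 q = len q by rewrite dist1.
  have h8 : dist 1 m = i by rewrite dist1.
  have f1 := hn_four_point hN 1 y p (y * q).
  have f2 := hn_four_point hN q y p (y * q).
  have f3 := hn_four_point hN 1 q (y * q) y.
  have f4 := hn_four_point hN m 1 p q.
  have := dist_tri 1 y (y * q); have := dist_tri 1 p (y * q).
  have := distC p m; have := distC p 1; have := distC m 1; have := distC p q.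
  have := distC p y; have := distC y q; have := distC (y * q) q; have := distC (y * q) y.
  have := distC (y * q) p; have := distC y 1.
  len_lia.
have shift j : (i <= a j + len (x ^+ j))%N /\ (a j <= i + len (x ^+ j))%N.
  have := dist_tri (x ^+ j) 1 (x ^+ j * m).
  have := distC 1 (x ^+ j); have := dist_mul (x ^+ j) m.
  have := dist1 (x ^+ j * m); have := dist1 (x ^+ j).
  have := lenM (x ^+ j) m; rewrite /a; split; len_lia.
(* Among [x ^- j], 1, [m], [x ^+ j * m], the first two are close and so are the last two. The two
   sums of long distances, [a (2 * j) + i] and [2 * a j], thus differ by at most [D]. *)
have double j : (2 * j <= J)%N ->
    (a (2 * j) + i <= 2 * a j + D)%N /\ (2 * a j <= a (2 * j) + i + D)%N.
  move=> jJ; have jJ' : (j <= J)%N by lia.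
  have := near j jJ'; have := lenJ j jJ'; have := lenJ _ jJ.
  have h1 : dist (x ^+ j)^-1 (x ^+ j * m) = a (2 * j)%N.
    by rewrite invgK mulgA -expgnDr addnn -mul2n.
  have h2 : dist (x ^+ j)^-1 m = a j by rewrite invgK.
  have h3 : dist 1 (x ^+ j * m) = a j by rewrite dist1.
  have h4 : dist 1 m = i by rewrite dist1.
  have h5 : dist 1 (x ^+ j)^-1 = len (x ^+ j) by rewrite dist1 lenV.
  have f1 := hn_four_point hN (x ^+ j)^-1 1 (x ^+ j * m) m.
  have f2 := hn_four_point hN (x ^+ j)^-1 1 m (x ^+ j * m).
  have := distC (x ^+ j)^-1 1; have := distC m 1; have := distC (x ^+ j * m) m.
  have := distC m (x ^+ j)^-1; have := distC (x ^+ j * m) 1.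
  have [s1 s2] := shift (2 * j)%N; have [s3 s4] := shift j.
  have := near j jJ'; have := lenJ j jJ'; have := lenJ _ jJ.
  len_lia.
have [j jJ far] : exists2 j, (j <= size s)%N & (5 * D < dist m (x ^+ j * m))%N.
  apply: contrapT => h.
  have [|j1 [j2 [j12 _ /mulgI/mulIg/(infinite_order_inj xoo)]]] :=
    @seq_collision _ s (fun j => m^-1 * (x ^+ j * m)); last by lia.
  move=> j jJ; apply: sP; rewrite leqNgt; apply/negP => far.
  by apply: h; exists j.
have j0 : (0 < j)%N.
  by rewrite lt0n; apply: contraPneq far => ->; rewrite mul1g mulVg len1.
have k0 : (0 < 2 ^ k)%N by rewrite expn_gt0.
(* The radius [5 * D] minus the error [4 * D] of [near] leaves a shift of at least [D + 1]; doubling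
   [D + 2 ^ t] at a loss of [D] leaves [D + 2 ^ t.+1]. *)
have grow t : (t <= k)%N -> (i + D + 2 ^ t <= a (2 ^ t * j))%N \/
    (a (2 ^ t * j) + D + 2 ^ t <= i)%N.
  elim: t => [_|t ih tk].
    by have := near j; rewrite expn0 mul1n /J; nia.
  have /double : (2 * (2 ^ t * j) <= J)%N.
    by rewrite mulnA -expnS leq_mul // leq_exp2l.
  by rewrite mulnA -expnS; have := ih (ltnW tk); rewrite !expnS; lia.
(* The shift is at least [2 ^ k], but also at most the length of [x ^+ (2 ^ k * j)], hence at most
   [size s * len x + k * B], against the choice of [k]. *)
have := grow k (leqnn k); have := shift (2 ^ k * j)%N; have := slowX k j j0.
have := len_exp_le x j; have : (j * len x <= size s * len x)%N.
  by rewrite leq_mul2r jJ orbT.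
by len_lia.
Qed.

(** The second clause says that [y ^+ s] lies on a geodesic from 1 to [y ^+ (s + t)] up to the
    additive error [c]. *)
Definition quasi_axis (y : G) c :=
  (forall n, (n <= len (y ^+ n))%N) /\
  (forall s t, (len (y ^+ s) + len (y ^+ t) <= len (y ^+ (s + t)) + c)%N).

Lemma exists_quasi_axis x : infinite_order x ->
  exists j c, (0 < j)%N /\ quasi_axis (x ^+ j) c.
Proof.
move=> xoo; have [j j0] := exists_doubling_power (2 * D) xoo.
rewrite (mulnC 2 j) expgnA => big.
suff [c ?] : exists c, quasi_axis (x ^+ j) c by exists j, c.
move: (x ^+ j) big => y big.
(* [a] is the backtracking in [y * y]. The hypothesis on [y ^+ 2] gives [a + 2 * D < len y], which
   rules out the bad alternative of the four-point inequality in [step]; one more four-point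
   inequality yields the error [a + 2 * D]. *)
pose a := (2 * len y - len (y ^+ 2))%N; exists (a + 2 * D)%N.
have ha : (a + len (y ^+ 2) = 2 * len y)%N.
  by rewrite subnK ?len_exp_le.
clearbody a.
have step n : (len (y ^+ n) + len y <= len (y ^+ n.+1) + a + D)%N.
  elim: n => [|n ih]; first by rewrite expg1 len1; lia.
  have := hn_four_point hN (y ^+ n) 1 (y ^+ n.+2) (y ^+ n.+1).
  have h1 : dist (y ^+ n) (y ^+ n.+2) = len (y ^+ 2) by rewrite -addn2 distX.
  have h2 : dist (y ^+ n) (y ^+ n.+1) = len y by rewrite -addn1 distX.
  have h3 : dist (y ^+ n.+1) (y ^+ n.+2) = len y by rewrite -(addn1 n.+1) distX.
  have := distC (y ^+ n) 1; have := distC (y ^+ n.+2) (y ^+ n.+1).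
  have := dist1 (y ^+ n); have := dist1 (y ^+ n.+1).
  have := dist1 (y ^+ n.+2); have := lenM y y; len_lia.
split.
  elim=> [|n ih] //; have := step n; len_lia.
case=> [|i] k; first by rewrite len1; len_lia.
have := hn_four_point hN 1 (y ^+ i) (y ^+ i.+1) (y ^+ (i.+1 + k)).
have h1 : dist (y ^+ i) (y ^+ (i.+1 + k)) = len (y ^+ k.+1).
  by rewrite addSnnS distX.
have h2 : dist (y ^+ i) (y ^+ i.+1) = len y by rewrite -addn1 distX.
have h3 : dist (y ^+ i.+1) (y ^+ (i.+1 + k)) = len (y ^+ k) by rewrite distX.
have := dist1 (y ^+ i); have := dist1 (y ^+ i.+1).
have := dist1 (y ^+ (i.+1 + k)).
have := step i; have := step k; len_lia.
Qed.

Lemma quasi_axisV y c : quasi_axis y c -> quasi_axis y^-1 c.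
Proof. by case=> h1 h2; split=> [n|s t]; rewrite !expVgn !lenV. Qed.

Lemma quasi_axisX y c a : quasi_axis y c -> (0 < a)%N -> quasi_axis (y ^+ a) c.
Proof.
case=> h1 h2 a0; split=> [n|s t]; rewrite -!expgnA; last by rewrite mulnDr.
by apply: leq_trans (h1 _); rewrite leq_pmull.
Qed.

Lemma quasi_axis_infinite y c : quasi_axis y c -> infinite_order y.
Proof. by case=> h1 _ n n0 e; have := h1 n; rewrite e len1 leqNgt n0. Qed.

(** Discrete intermediate values: consecutive powers differ in length by at most [len y]. *)
Lemma exp_near_level y n r : (r <= len (y ^+ n))%N ->
  exists2 t, (t <= n)%N & (len (y ^+ t) <= r <= len (y ^+ t) + len y)%N.
Proof.
elim: n => [|n ih] rn; first by exists 0%N => //; move: rn; rewrite len1; lia.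
case: (leqP r (len (y ^+ n))) => [/ih[t tn tr]|nr].
  by exists t => //; apply: leqW.
exists n => //; have := lenM (y ^+ n) y; rewrite -expgSr; move: rn nr; len_lia.
Qed.

(** Thin bigons: [u] and [v] lie almost on a geodesic from [P] to [Q], at almost the same distance
    from [P]. *)
Lemma dist_le_same_level P Q u v c e :
  (dist P u + dist u Q <= dist P Q + c)%N ->
  (dist P v + dist v Q <= dist P Q + c)%N ->
  (dist P v <= dist P u <= dist P v + e)%N -> (dist u v <= c + e + D)%N.
Proof.
have := hn_four_point hN u P v Q; have := distC u P; len_lia.
Qed.

(* Two quasi-axes that fellow-travel for long enough carry more pairs of nearby
   powers than there are elements in a ball, so a pair of differences repeats. *)
Lemma fellow_travel_commensurable y z c c' :
  quasi_axis y c -> quasi_axis z c' -> exists T, forall n m,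
    (dist (y ^+ n) (z ^+ m) + T < len (y ^+ n) + len (z ^+ m))%N ->
    exists a i j, (0 < a)%N /\ y ^+ a = z ^+ i * (z ^+ j)^-1.
Proof.
move=> [y1 y2] [z1 z2]; pose R := (c + c' + 2 * len z + 2 * D)%N.
have [s sP] := hn_ball hN R; pose M := size s.
(* With this constant the Gromov product of [y ^+ n] and [z ^+ m] exceeds the length of every
   [y ^+ k] with [k <= M], so each such power has a power of [z] nearby. *)
exists (2 * (M * len y))%N => n m far.
have tri1 := dist_tri 1 (z ^+ m) (y ^+ n).
have tri2 := dist_tri 1 (y ^+ n) (z ^+ m).
rewrite !dist1 (distC (z ^+ m)) in tri1 tri2.
have lyn := len_exp_le y n.
have Mn : (M < n)%N.
  by rewrite ltnNge; apply/negP => nM; have := leq_mul nM (leqnn (len y)); lia.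
have ys k : (k <= M)%N -> (len (y ^+ k) <= M * len y)%N.
  by move=> kM; apply: leq_trans (len_exp_le _ _) _; rewrite leq_mul2r kM orbT.
have near k : exists t, (k <= M)%N -> (dist (y ^+ k) (z ^+ t) <= R)%N.
  case: (leqP k M) => [kM|]; last by exists 0%N.
  have [|t tm tz] := @exp_near_level z m (len (y ^+ k)).
    by have := ys k kM; len_lia.
  exists t => _; have := ys k kM.
  have := hn_four_point hN (y ^+ k) (y ^+ n) (z ^+ m) 1.
  have := hn_four_point hN (y ^+ k) (z ^+ m) (z ^+ t) 1.
  have := y2 k (n - k)%N; have := distX y k (n - k).
  have := z2 t (m - t)%N; have := distX z t (m - t).
  rewrite !subnKC //; last by lia.
  have := distC (z ^+ t) (z ^+ m); rewrite !mulg1 !lenV /R.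
  by len_lia.
have [t tP] := choice near.
have [|i [j [ij _ e]]] := @seq_collision _ s (fun k => (y ^+ k)^-1 * z ^+ t k).
  by move=> k kM; apply: sP; apply: tP.
exists (j - i)%N, (t j), (t i); split; first by rewrite subn_gt0.
rewrite expgnFr; last exact: ltnW.
have -> : z ^+ t j = y ^+ j * ((y ^+ i)^-1 * z ^+ t i) by rewrite e mulVKg.
by gsimp.
Qed.

(** High powers [X], [Z] satisfy [u * Z = X * u], so [u * Z] and [u * Z^-1] are within [len u] of
    [X] and [X^-1]. As [u] is almost on a geodesic between the former, far from its ends, it is
    almost on one between the latter, near a power of [x]. The resulting bound is independent of
    [u]. *)
Lemma near_axis x z c p q u :
  quasi_axis x c -> quasi_axis z c -> (0 < p)%N -> (0 < q)%N ->
  u * z ^+ q = x ^+ p * u ->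
  exists i j, (len (((x ^+ i)^-1 * x ^+ j)^-1 * u) <= c + 3 * D + len x)%N.
Proof.
move=> [x1 x2] [z1 z2] p0 q0 e.
pose n := (2 * len u + c + 2 * D + 1)%N.
have en : u * (z ^+ q) ^+ n = (x ^+ p) ^+ n * u.
  elim: n => [|n ih]; first by rewrite mulg1 mul1g.
  by rewrite expgS mulgA e -mulgA ih mulgA -expgS.
set X := (x ^+ p) ^+ n in en; set Z := (z ^+ q) ^+ n in en.
have lZ : (n <= len Z)%N.
  by rewrite /Z -expgnA; apply: leq_trans (z1 _); rewrite leq_pmull.
have lZ2 : (len Z + len Z <= len (Z * Z) + c)%N.
  by rewrite /Z -!expgnA -expgnDr; apply: z2.
pose P := X^-1; pose Q := X.
have enV : u * Z^-1 = X^-1 * u by rewrite -{2}(mulgK Z u) en; gsimp.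
have h1 : dist u (u * Z^-1) = len Z by rewrite dist_mul lenV.
have h2 : dist u (u * Z) = len Z by rewrite dist_mul.
have h3 : dist (u * Z^-1) (u * Z) = len (Z * Z) by rewrite distM invgK.
have h4 : dist P (u * Z^-1) = len u by rewrite enV dist_mul.
have h5 : dist Q (u * Z) = len u by rewrite en dist_mul.
have f1 := hn_four_point hN (u * Z^-1) P (u * Z) u.
have f2 := hn_four_point hN P Q (u * Z) u.
have f3 := hn_four_point hN P (u * Z) Q u.
have f4 := hn_four_point hN (u * Z^-1) (u * Z) P u.
have uPQ : (dist P u + dist u Q <= dist P Q + c + 2 * D)%N.
  move: f1 f2 f3 f4.
  have := distC u (u * Z^-1); have := distC u (u * Z); have := distC (u * Z^-1) P.
  have := distC (u * Z) Q; have := distC P u; have := distC Q u.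
  have := distC P (u * Z); have := distC (u * Z^-1) (u * Z).
  have := dist_tri u P (u * Z^-1); have := dist_tri u Q (u * Z).
  rewrite /n in lZ; len_lia.
have Quse : (c + 2 * D <= dist u Q)%N.
  have := dist_tri u Q (u * Z); rewrite /n in lZ; len_lia.
have PQ : dist P Q = len (x ^+ (2 * (p * n))).
  by rewrite /P /Q invgK /X -!expgnA -expgnDr addnn mul2n.
have [|t tn tP] := @exp_near_level x (2 * (p * n)) (dist P u).
  by move: PQ; len_lia.
exists (p * n)%N, t; set v := _ * x ^+ t.
have vP : v = P * x ^+ t by rewrite /v /P /X -expgnA.
have h6 : dist P v = len (x ^+ t) by rewrite vP dist_mul.
have h7 : dist v Q = len (x ^+ (2 * (p * n) - t)).
  have -> : Q = P * x ^+ (2 * (p * n)).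
    by rewrite mul2n -addnn expgnDr /P /Q /X -expgnA mulKg.
  by rewrite vP distM -{1}(subnKC tn) distX.
have h8 := x2 t (2 * (p * n) - t)%N; rewrite subnKC // in h8.
have := @dist_le_same_level P Q u v (c + 2 * D) (len x).
rewrite (distC v u) => h; have : (dist u v <= c + 2 * D + len x + D)%N.
  by apply: h; move: uPQ h6 h7 h8 tP PQ; len_lia.
by rewrite (distC u v); len_lia.
Qed.

Lemma commensurator_elementary x c : quasi_axis x c -> elementary (commensurator x).
Proof.
move=> ax; have gE := commensurator_subgroup x; split=> //.
have gx := cyclic_subgroup_subgroup x.
have xE : commensurator x x.
  by exists 1%N, 1%N; split=> //; left; rewrite conjgE mulKg.
exists x; split.
  move=> _ [n [->|->]]; last apply: subgroupV => //; exact: subgroupX.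
have [s sP] := hn_ball hN (c + 3 * D + len x).
pose coset g := [set g * k | k in cyclic_subgroup x].
apply: (@sub_finite_set _ _ (coset @` [set` s])); last first.
  exact/finite_image/finite_seq.
have near u : commensurator x u ->
    exists i j, (len (((x ^+ i)^-1 * x ^+ j)^-1 * u) <= c + 3 * D + len x)%N.
  move=> [a [b [a0 b0]]] /= [] e.
    by apply: (near_axis ax ax a0 b0); rewrite -e conjgE; gsimp.
  by apply: (near_axis ax (quasi_axisV ax) a0 b0); rewrite expVgn -e conjgE; gsimp.
move=> _ [u uE <-].
(* [near] puts a power of [x] to the left of a bounded element; passing to the inverse of [u] turns
   this into a bounded representative of the left coset of [u]. *)
have [i [j ij]] := near _ (subgroupV gE uE).
set v := (x ^+ i)^-1 * x ^+ j in ij.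
have xv : cyclic_subgroup x v by apply/cyclic_subgroupP; exists i, j.
exists (u * v).
  apply: sP; rewrite -lenV invgM; len_lia.
by apply/(left_coset_eq gx); rewrite invgM mulgVK; apply: subgroupV.
Qed.

(** Both subgroups lie in the commensurator of a power of [x] that has a quasi-axis. It is
    elementary, so by maximality both equal it. *)
Lemma maximal_elementary_eq (H K : set G) x : maximal_elementary H ->
  maximal_elementary K -> H x -> K x -> infinite_order x -> H = K.
Proof.
move=> [eH mH] [eK mK] xH xK xoo.
have [j [c [j0 ax]]] := exists_quasi_axis xoo.
have xjoo := quasi_axis_infinite ax.
have eC := commensurator_elementary ax.
rewrite -(mH _ eC); last first.
  by apply: elementary_sub_commensurator => //; apply: subgroupX => //; case: eH.
apply: mK => //.
by apply: elementary_sub_commensurator => //; apply: subgroupX => //; case: eK.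
Qed.

Lemma infinite_elementary_axis (H : set G) : elementary H -> infinite_set H ->
  exists y c R, [/\ quasi_axis y c, H y & forall h, H h ->
    exists n f, (len f <= R)%N /\ (h = y ^+ n * f \/ h = y ^- n * f)].
Proof.
move=> [gH [c [cH fi]]] Hoo; have coo := infinite_elementary_order Hoo fi.
have gc := cyclic_subgroup_subgroup c.
have [j [c' [j0 ax]]] := exists_quasi_axis coo.
have [s sE] := (finite_seqP _).1 fi.
have [||r rP] := @seq_uniform_bound _ s
  (fun (K : set G) r => exists2 g, K g & (len g <= r)%N).
- by move=> K m n mn [g Kg gm]; exists g => //; apply: leq_trans mn.
- move=> K Ks; have : left_cosets (cyclic_subgroup c) H K by rewrite sE.
  move=> [h _ <-]; exists (len h), h => //; exact: left_coset_self.
(* [r] bounds chosen coset representatives, and [j * len c] bounds the remainder of an exponent of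
   [c] modulo [j]. *)
exists (c ^+ j), c', (j * len c + r)%N; split=> //.
  exact/cH/cyclic_subgroup_exp.
move=> h hH.
have [|_ [k kc <-] gr] := rP [set h^-1 * k | k in cyclic_subgroup c].
  suff : left_cosets (cyclic_subgroup c) H [set h^-1 * k | k in cyclic_subgroup c].
    by rewrite sE.
  by exists h^-1 => //; apply: subgroupV.
case: kc gr => m km gr; exists (m %/ j)%N.
have cm : c ^+ m = (c ^+ j) ^+ (m %/ j) * c ^+ (m %% j).
  by rewrite {1}(divn_eq m j) expgnDr mulnC expgnA.
have lr : (len (c ^+ (m %% j)) <= j * len c)%N.
  apply: leq_trans (len_exp_le _ _) _.
  by rewrite leq_mul2r (ltnW (ltn_pmod _ j0)) orbT.
have bound v : (len v <= j * len c)%N -> (len (v * (h^-1 * k)^-1) <= j * len c + r)%N.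
  by have := lenM v (h^-1 * k)^-1; rewrite (lenV (h^-1 * k)); len_lia.
case: km gr => -> gr.
  exists (c ^+ (m %% j) * (h^-1 * c ^+ m)^-1); split; last first.
    by left; rewrite mulgA -cm; gsimp.
  by apply: leq_trans (lenM _ _) _; rewrite lenV; len_lia.
exists (c ^- (m %% j) * (h^-1 * c ^- m)^-1); split; last first.
  right; rewrite mulgA -invgM.
  have -> : c ^+ (m %% j) * (c ^+ j) ^+ (m %/ j) = c ^+ m.
    by rewrite -expgnA -expgnDr addnC mulnC -divn_eq.
  by gsimp.
by apply: leq_trans (lenM _ _) _; rewrite !lenV; len_lia.
Qed.

Lemma maximal_elementary_diverge (H K : set G) :
  maximal_elementary H -> infinite_set H ->
  maximal_elementary K -> infinite_set K -> H <> K ->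
  exists T, forall h k, H h -> K k -> (len h + len k <= dist h k + T)%N.
Proof.
move=> mH Hoo mK Koo HK.
have [y [c [R [ay yH hP]]]] := infinite_elementary_axis mH.1 Hoo.
have [z [c' [R' [az zK kP]]]] := infinite_elementary_axis mK.1 Koo.
have gH := mH.1.1; have gK := mK.1.1.
have axes y' z' : quasi_axis y' c -> H y' -> quasi_axis z' c' -> K z' ->
    exists T, forall n m, (len (y' ^+ n) + len (z' ^+ m)
      <= dist (y' ^+ n) (z' ^+ m) + T)%N.
  move=> ay' yH' az' zK'; have [T TP] := fellow_travel_commensurable ay' az'.
  exists T => n m; rewrite leqNgt; apply/negP => /TP[a [i [j [a0 e]]]].
  apply: HK; apply: (@maximal_elementary_eq _ _ (y' ^+ a)) => //.
  - exact: subgroupX.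
  - by rewrite e; apply: (subgroupM gK); last apply: (subgroupV gK); exact: subgroupX.
  - apply: (quasi_axis_infinite (c := c)).
    exact: quasi_axisX.
have yV := subgroupV gH yH; have zV := subgroupV gK zK.
have ayV := quasi_axisV ay; have azV := quasi_axisV az.
(* Elements of [H] and [K] are, up to bounded right factors, powers of [y] or its inverse and of [z]
   or its inverse, so four sign choices cover all pairs. *)
have [T1 P1] := axes _ _ ay yH az zK; have [T2 P2] := axes _ _ ayV yV az zK.
have [T3 P3] := axes _ _ ay yH azV zV; have [T4 P4] := axes _ _ ayV yV azV zV.
exists (T1 + T2 + T3 + T4 + 2 * R + 2 * R')%N => h k /hP[n [f [fR hE]]] /kP[m [g [gR kE]]].
have near v w : (len v + len w <= dist v w + (T1 + T2 + T3 + T4))%N ->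
    (len (v * f) + len (w * g)
       <= dist (v * f) (w * g) + (T1 + T2 + T3 + T4 + 2 * R + 2 * R'))%N.
  have := lenM v f; have := lenM w g.
  have := dist_tri v (v * f) w; have := dist_tri (v * f) (w * g) w.
  have := distC (w * g) w; rewrite !dist_mul; len_lia.
have := P1 n m; have := P2 n m; have := P3 n m; have := P4 n m.
rewrite !expVgn => p4 p3 p2 p1.
by case: hE => ->; case: kE => ->; apply: near; [move: p1|move: p3|move: p2|move: p4];
  len_lia.
Qed.

(** * Products of maximal elementary subgroups *)

(* The elements [e * h_1 * g_1 * ... * h_n * g_n] with [h_i] in [H_i] of length
   at least [C], where [L] lists the pairs [(H_i, g_i)]. *)
Fixpoint long_product C (e : G) (L : seq (set G * G)) : set G :=
  if L is (H, g) :: L' then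
    [set x | exists h y, [/\ H h, (C <= len h)%N, long_product C g L' y & x = e * h * y]]
  else [set e].

Local Notation product := (long_product 0).

Lemma long_productS C C' e L : (C <= C')%N ->
  long_product C' e L `<=` long_product C e L.
Proof.
move=> CC; elim: L e => [|[H g] L ih] e x //= [h [y [hH Ch yL ->]]].
by exists h, y; split=> //; [apply: leq_trans Ch|apply: ih].
Qed.

Lemma long_product_mul C a e L x :
  long_product C e L x -> long_product C (a * e) L (a * x).
Proof.
case: L => [|[H g] L] /=; first by move=> ->.
by move=> [h [y [hH Ch yL ->]]]; exists h, y; split=> //; rewrite !mulgA.
Qed.

Lemma long_product_mulV C a e L x :
  long_product C (a * e) L (a * x) -> long_product C e L x.
Proof. by move/(long_product_mul a^-1); rewrite !mulKg. Qed.

(** The next long factor [k] makes [y] start along [g * k], by induction. That point is within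
    [len g] of g K g^-1, which diverges from [H]; the four-point inequality then bounds the
    cancellation between [h] and [y]. *)
Lemma reduced_product_direction H g L : reduced ((H, g) :: L) ->
  exists C b, forall h y, H h -> (C <= len h)%N -> long_product C g L y ->
    (len h + len y <= len (h * y)%g + b)%N.
Proof.
elim: L H g => [|[K f] L ih] H g /=.
  move=> _; exists 0%N, (2 * len g)%N => h _ hH _ ->.
  have := lenM (h * g) g^-1; rewrite mulgK lenV; len_lia.
move=> [[mH Hoo] HK rL]; have [C [b Cb]] := ih _ _ rL.
have [[mK Koo] _ _] := rL.
have [T HT] := maximal_elementary_diverge mH Hoo
  (conj_set_maximal_elementary g mK) (@conj_set_infinite _ g _ Koo) HK.
pose C' := (C + T + b + 4 * len g + D + 1)%N.
exists C', (T + 2 * len g + D)%N => h _ hH Ch [k [z [kK Ck zL ->]]].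
have CC : (C <= C')%N by rewrite /C'; lia.
have h1 := Cb k z kK (leq_trans CC Ck) (long_productS CC zL).
have h2 : (len h^-1 + len (k ^ g^-1) <= dist h^-1 (k ^ g^-1) + T)%N.
  apply: HT; first by apply: subgroupV => //; apply: mH.1.1.
  by rewrite /conj_set /= -conjgM mulVg conjg1.
have h3 : dist (k ^ g^-1) (g * k) = len g.
  by congr len; rewrite conjgE; gsimp.
set y := g * k * z.
have h4 : dist h^-1 y = len (h * y) by rewrite invgK.
have h5 : dist (g * k) y = len z by rewrite dist_mul.
have h6 : (len (k * z)%g <= len g + len y)%N.
  by have := lenM g^-1 y; rewrite /y -mulgA mulKg lenV.
have h7 : (len k <= len g + len (g * k)%g)%N.
  by have := lenM g^-1 (g * k); rewrite mulKg lenV.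
have four := hn_four_point hN h^-1 y (g * k) 1.
have := distC h^-1 1; have := distC (g * k) 1; have := distC y 1.
have := distC y (g * k).
have := dist1 h^-1; have := dist1 (g * k); have := dist1 y.
have := lenV h; have := dist_tri h^-1 (g * k) (k ^ g^-1).
have := distC (g * k) (k ^ g^-1); have := dist_tri 1 (k ^ g^-1) (g * k).
have := dist1 (k ^ g^-1); rewrite /C' in Ck Ch.
by len_lia.
Qed.

Lemma long_product_far L e r : reduced L -> L <> [::] ->
  exists C, forall x, long_product C e L x -> (r < len x)%N.
Proof.
case: L => // -[H g] L rL _.
have [C [b Cb]] := reduced_product_direction rL.
pose C' := (C + b + len e + r + 1)%N; have CC : (C <= C')%N by rewrite /C'; lia.
exists C' => x [h [y [hH Ch yL ->]]].
have := Cb h y hH (leq_trans CC Ch) (long_productS CC yL).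
have := lenM e^-1 (e * h * y); rewrite -(mulgA e) mulKg lenV /C' in Ch *.
have := lenM (h * y) y^-1; rewrite mulgK lenV; len_lia.
Qed.

(** A common element would have large Gromov products both with [h] and with [w * k], hence these
    two with each other, although [H] and w K w^-1 diverge. *)
Lemma long_product_apart H g L w M :
  reduced ((H, g) :: L) -> reduced M -> apart H w M ->
  exists C, forall x,
    long_product C 1 ((H, g) :: L) x -> long_product C w M x -> False.
Proof.
move=> rL; case: M => [|[K f] M] rM HK.
  have [//|C CP] := @long_product_far _ 1 (len w) rL.
  by exists C => x /CP + xw; rewrite xw ltnn.
have [[mH Hoo] _ _] := rL; have [[mK Koo] _ _] := rM.
have [T HT] := maximal_elementary_diverge mH Hoo
  (conj_set_maximal_elementary w mK) (@conj_set_infinite _ w _ Koo) HK.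
have [C1 [b1 P1]] := reduced_product_direction rL.
have [C2 [b2 P2]] := reduced_product_direction rM.
pose C := (C1 + C2 + b1 + b2 + T + 4 * len w + 2 * D + 1)%N.
have CC1 : (C1 <= C)%N by rewrite /C; lia.
have CC2 : (C2 <= C)%N by rewrite /C; lia.
exists C => x [h [y [hH Ch yL xE]]] [k [z [kK Ck zM xE']]].
have h1 := P1 h y hH (leq_trans CC1 Ch) (long_productS CC1 yL).
have h2 := P2 k z kK (leq_trans CC2 Ck) (long_productS CC2 zM).
rewrite mul1g in xE; rewrite -xE in h1.
have h3 : (len h + len (k ^ w^-1) <= dist h (k ^ w^-1) + T)%N.
  by apply: HT => //; rewrite /conj_set /= -conjgM mulVg conjg1.
have h4 : dist (k ^ w^-1) (w * k) = len w by congr len; rewrite conjgE; gsimp.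
have h5 : dist h x = len y by rewrite xE dist_mul.
have h6 : dist (w * k) x = len z by rewrite xE' dist_mul.
have h7 : (len (k * z)%g <= len w + len x)%N.
  by have := lenM w^-1 x; rewrite xE' -mulgA mulKg lenV.
have h8 : (len k <= len w + len (w * k)%g)%N.
  by have := lenM w^-1 (w * k); rewrite mulKg lenV.
have := hn_four_point hN h x (w * k) 1.
have := distC h 1; have := distC (w * k) 1; have := distC x 1.
have := distC x (w * k).
have := dist1 h; have := dist1 (w * k); have := dist1 x; have := dist1 (k ^ w^-1).
have := dist_tri h (w * k) (k ^ w^-1); have := dist_tri 1 (k ^ w^-1) (w * k).
have := distC (w * k) (k ^ w^-1); rewrite /C in Ck Ch.
by len_lia.
Qed.

(* Common long elements force the leading cosets [e H] and [e' K] to agree up to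
   a left factor [u] of [H]; if [u] were long, [u * y] would start along [H] and
   along the second factor of [M] at once, so [u] ranges over a finite set. *)
Lemma long_product_sub L M e e' : reduced L -> reduced M ->
  exists C, forall x, long_product C e L x -> long_product C e' M x ->
    product e L `<=` product e' M.
Proof.
elim: L M e e' => [|[H f] L ih] [|[K g] M] e e' rL rM.
- by exists 0%N => x -> <-.
- have [//|C CP] := @long_product_far _ e' (len e) rM.
  by exists C => x -> /CP; rewrite ltnn.
- have [//|C CP] := @long_product_far _ e (len e') rL.
  by exists C => x /CP + xe; rewrite xe ltnn.
pose w := e^-1 * e'.
have [HK|HK] := pselect (H = conj_set w K); last first.
  have [C CP] := @long_product_apart H f L w ((K, g) :: M) rL rM HK.
  exists C => x xL xM; exfalso; apply: (CP (e^-1 * x)).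
    by apply: (@long_product_mulV _ e); rewrite mulg1 mulVKg.
  by apply: (@long_product_mulV _ e); rewrite !mulVKg.
have [[mH Hoo] _ rL'] := rL; have [_ KM rM'] := rM.
have [C1 CP1] : exists C, forall x, long_product C 1 ((H, f) :: L) x ->
    long_product C (w * g) M x -> False.
  apply: long_product_apart => //; rewrite HK; exact: apart_conj.
have gH := mH.1.1.
have [s sP] := hn_ball hN C1.
have [||C2 CP2] := @seq_uniform_bound _ s (fun u C => forall x,
  long_product C (u * f) L x -> long_product C (w * g) M x ->
  product (u * f) L `<=` product (w * g) M).
- by move=> u m n mn hm x xL xM; apply: (hm x); apply: long_productS xL || apply: long_productS xM.
- by move=> u _; apply: ih.
pose C := maxn C1 C2.
have CC1 : (C1 <= C)%N by exact: leq_maxl.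
have CC2 : (C2 <= C)%N by exact: leq_maxr.
exists C => x [h [y [hH Ch yL xE]]] [k [z [kK Ck zM xE']]].
pose u := (k ^ w^-1)^-1 * h.
have uH : H u.
  apply: (subgroupM gH) => //; apply: (subgroupV gH).
  by rewrite HK /conj_set /= -conjgM mulVg conjg1.
have uy : u * y = w * z.
  have -> : y = (e * h)^-1 * x by rewrite xE mulKg.
  by rewrite xE' /u conjgE /w; gsimp.
have uyL := long_product_mul u yL; have wzM := long_product_mul w zM.
have [uC|uC] := leqP C1 (len u).
  exfalso; apply: (CP1 (u * y)); last by rewrite uy; apply: long_productS wzM.
  by exists u, y; split=> //; [apply: long_productS yL|rewrite mul1g].
have us : u \in s by apply/sP/ltnW.
have sub := CP2 u us (u * y) (long_productS CC2 uyL).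
rewrite uy in sub; have {}sub := sub (long_productS CC2 wzM).
move=> _ [h' [y' [h'H _ y'L ->]]].
have := sub _ (long_product_mul u y'L).
move=> /(long_product_mul w^-1); rewrite mulKg => z'M.
(* Insert [u^-1 * u] after [h'], and use that conjugation by [w] carries [H] to [K]. *)
exists ((h' * u^-1) ^ w), (w^-1 * (u * y')); split=> //.
  have : H (h' * u^-1) by apply: (subgroupM gH) => //; apply: (subgroupV gH).
  by rewrite HK.
by rewrite conjgE /w; gsimp.
Qed.

Fixpoint factors (L : seq (set G * G)) : Prop :=
  if L is (H, g) :: L' then infinite_maximal_elementary H /\ factors L' else True.

Lemma reduced_factors L : reduced L -> factors L.
Proof. by elim: L => [|[H g] L ih] //= [h _ /ih]. Qed.

Lemma product_cons e H g L :
  product e ((H, g) :: L) =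
  [set x | exists h y, [/\ H h, product g L y & x = e * h * y]].
Proof.
by apply/seteqP; split=> x [h [y]]; [move=> [hH _ yL ->]|move=> [hH yL ->]];
  exists h, y.
Qed.

(* When [H = f K f^-1] the factor [K] is absorbed: [H f K g = H f g]. *)
Lemma factors_reduce e L : factors L ->
  exists e' L', [/\ reduced L', (size L' <= size L)%N & product e L = product e' L'].
Proof.
elim: L e => [|[H f] L ih] e; first by exists e, [::].
move=> [mH /(ih f)[f' [L' [rL sL LE]]]].
have {}LE : product e ((H, f) :: L) = product e ((H, f') :: L').
  by rewrite !product_cons LE.
have [HL|HL] := pselect (apart H f' L').
  by exists e, ((H, f') :: L').
case: L' rL sL LE HL => [|[K g] L1] rL sL LE HL; first by case: HL.
have HK : H = conj_set f' K by apply: contrapT => h; exact: HL.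
have [_ KL1 rL1] := rL.
exists e, ((H, f' * g) :: L1); split.
- by split=> //; rewrite HK; apply: apart_conj.
- by rewrite /= ltnS; apply: leq_trans sL; rewrite /= leqnSn.
have gH := mH.1.1.1; rewrite LE !product_cons; apply/seteqP; split=> x [h [y [hH]]].
  move=> [k [z [kK zL ->]]] ->.
  exists (h * k ^ f'^-1), (f' * z); split.
  - by apply: (subgroupM gH) => //; rewrite HK /conj_set /= -conjgM mulVg conjg1.
  - exact: long_product_mul.
  - by rewrite conjgE; gsimp.
move=> yL ->; exists h, y; split=> //.
exists 1, (f'^-1 * y); split; [|by apply: (@long_product_mulV _ f'); rewrite mulVKg|].
  by rewrite -(conj1g f'); have := subgroup1 gH; rewrite HK.
by rewrite mulg1 mulVKg.
Qed.

(** * Finite unions of products with few factors *)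

Inductive short_union (n : nat) : set G -> Prop :=
| short_union0 : short_union n set0
| short_union1 e L : reduced L -> (size L < n)%N -> short_union n (product e L)
| short_unionU S T : short_union n S -> short_union n T -> short_union n (S `|` T).

Lemma short_unionS n m S : (n <= m)%N -> short_union n S -> short_union m S.
Proof.
move=> nm; elim=> [|e L rL sL|S' T _ hS _ hT]; first exact: short_union0.
  by apply: short_union1 => //; apply: leq_trans nm.
exact: short_unionU.
Qed.

Lemma short_union_seq n (T : eqType) (s : seq T) (P : set T) (F : T -> set G) :
  (forall a, a \in s -> P a -> short_union n (F a)) ->
  short_union n [set x | exists a, [/\ a \in s, P a & F a x]].
Proof.
elim: s => [|a s ih] h.
  rewrite (_ : [set x | _] = set0); first exact: short_union0.
  by apply/seteqP; split=> x // [b []].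
have {}ih := ih (fun b bs => h b (mem_behead (s := a :: s) bs)).
have [Pa|Pa] := pselect (P a).
  rewrite (_ : [set x | _] = F a `|` [set x | exists a, [/\ a \in s, P a & F a x]]).
    by apply: short_unionU => //; apply: h; rewrite ?mem_head.
  apply/seteqP; split=> x /=.
    move=> [b [+ Pb Fb]]; rewrite inE => /orP[/eqP <-|bs]; [by left|right].
    by exists b.
  move=> [Fa|[b [bs Pb Fb]]]; first by exists a; rewrite mem_head.
  by exists b; rewrite inE bs orbT.
rewrite (_ : [set x | _] = [set x | exists a, [/\ a \in s, P a & F a x]]) //.
apply/seteqP; split=> x /= [b [bs Pb Fb]]; exists b; split=> //.
  by move: bs; rewrite inE => /orP[/eqP ba|//]; rewrite ba in Pb.
by rewrite inE bs orbT.
Qed.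

(** Prepending a factor may destroy reducedness; [factors_reduce] restores it without adding
    factors. *)
Lemma short_union_cons n H e S : infinite_maximal_elementary H ->
  short_union n S ->
  short_union n.+1 [set x | exists h y, [/\ H h, S y & x = e * h * y]].
Proof.
move=> mH; elim=> [|e1 L rL sL|S1 S2 _ h1 _ h2].
- rewrite (_ : [set x | _] = set0); first exact: short_union0.
  by apply/seteqP; split=> x // [h [y []]].
- rewrite -product_cons.
  have [e' [L' [rL' sL' ->]]] : exists e' L', [/\ reduced L',
      (size L' <= size ((H, e1) :: L))%N & product e ((H, e1) :: L) = product e' L'].
    by apply: factors_reduce; split=> //; apply: reduced_factors.
  by apply: short_union1 => //; apply: leq_ltn_trans sL' _.
rewrite (_ : [set x | _] = [set x | exists h y, [/\ H h, S1 y & x = e * h * y]]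
  `|` [set x | exists h y, [/\ H h, S2 y & x = e * h * y]]); first exact: short_unionU.
apply/seteqP; split=> x /=.
  by move=> [h [y [hH [] Sy ->]]]; [left|right]; exists h, y.
by move=> [] [h [y [hH Sy ->]]]; exists h, y; split=> //; [left|right].
Qed.

(** A short first factor takes finitely many values, each absorbed into the coefficient; short
    factors further on are handled by induction. *)
Lemma long_product_or_short C e L : reduced L ->
  exists S, [/\ short_union (size L) S, S `<=` product e L &
    product e L `<=` long_product C e L `|` S].
Proof.
elim: L e => [|[H f] L ih] e rL.
  by exists set0; split; [exact: short_union0|move=> x|move=> x; left].
have [mH _ rL'] := rL; have [S [hS SL LS]] := ih f rL'.
have [s sP] := hn_ball hN C.
exists ([set x | exists h, [/\ h \in s, H h & product (e * h * f) L x]]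
  `|` [set x | exists h y, [/\ H h, S y & x = e * h * y]]); split.
- apply: short_unionU; last exact: short_union_cons.
  by apply: short_union_seq => h _ _; apply: short_union1.
- rewrite product_cons => x [[h [_ hH xL]]|[h [y [hH /SL yL ->]]]]; last by exists h, y.
  exists h, ((e * h)^-1 * x); split=> //; last by rewrite mulVKg.
  by apply: (@long_product_mulV _ (e * h)); rewrite mulVKg.
rewrite product_cons => x [h [y [hH yL ->]]].
have [Ch|Ch] := leqP C (len h).
  case: (LS y yL) => [yC|yS]; first by left; exists h, y.
  by right; right; exists h, y.
right; left; exists h; split=> //; first exact/sP/ltnW.
exact: long_product_mul.
Qed.

(** * Intersections of products *)

Lemma short_union_setI n m S Q : short_union n S ->
  (forall e L, reduced L -> (size L < n)%N -> short_union m (product e L `&` Q)) ->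
  short_union m (S `&` Q).
Proof.
move=> hS h; elim: hS => [|e L rL sL|S1 S2 _ h1 _ h2].
- by rewrite set0I; apply: short_union0.
- exact: h.
- by rewrite setIUl; apply: short_unionU.
Qed.

Lemma sub_or_short_union n m P S : short_union n S ->
  (forall e M, reduced M -> (size M < n)%N ->
    P `<=` product e M \/ short_union m (P `&` product e M)) ->
  P `<=` S \/ short_union m (P `&` S).
Proof.
move=> hS h; elim: hS => [|e L rL sL|S1 S2 _ h1 _ h2].
- by right; rewrite setI0; apply: short_union0.
- exact: h.
case: h1 => [h1|h1]; first by left=> x /h1; left.
case: h2 => [h2|h2]; first by left=> x /h2; right.
by right; rewrite setIUr; apply: short_unionU.
Qed.

(** Induction on the total number of factors. Without a common element having only long factors,
    every common element lies in the short part [S] of the first product or [T] of the second. *)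
Lemma product_setI e e' L M : reduced L -> reduced M ->
  product e L `<=` product e' M \/
  short_union (size L) (product e L `&` product e' M).
Proof.
have [k] := ubnP (size L + size M); elim: k L M e e' => // k ih L M e e' sk rL rM.
have [C CP] := long_product_sub e e' rL rM.
have [[x [xL xM]]|none] := pselect (exists x, long_product C e L x /\ long_product C e' M x).
  by left; apply: (CP x).
have [S [hS SL LS]] := long_product_or_short C e rL.
have [T [hT TM MT]] := long_product_or_short C e' rM.
have short : short_union (size L) (S `&` product e' M).
  apply: short_union_setI hS _ => e1 L1 rL1 sL1.
  have [|sub|h] := ih L1 M e1 e' _ rL1 rM; first by lia.
  - by rewrite (setIidl sub); apply: short_union1.
  - by apply: short_unionS h; apply: ltnW.
have [|PT|PT] := @sub_or_short_union _ (size L) (product e L) _ hT.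
- by move=> e2 M2 rM2 sM2; apply: ih => //; lia.
- by left; apply: subset_trans TM.
right; rewrite (_ : _ `&` _ = (S `&` product e' M) `|` (product e L `&` T)).
  exact: short_unionU.
apply/seteqP; split=> x.
  move=> [xL xM]; case: (LS x xL) => [lxL|xS]; last by left.
  by case: (MT x xM) => [lxM|xT]; [case: none; exists x|right].
by move=> [[/SL xL xM]|[xL /TM xM]].
Qed.

(** If some [U i] does not contain the product, intersecting with it leaves pieces with fewer
    factors, to which induction applies with the same family. *)
Lemma product_bigcap (I : Type) (E : set I) (U : I -> set G) e L : reduced L ->
  (forall i, E i -> exists n, short_union n (U i)) ->
  short_union (size L).+1 (product e L `&` \bigcap_(i in E) U i).
Proof.
move=> + hU; have [k] := ubnP (size L); elim: k L e => // k ih L e sk rL.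
have [sub|/existsNP[i /not_implyP[Ei Ui]]] :=
    pselect (forall i, E i -> product e L `<=` U i).
  rewrite setIidl; first exact: short_union1.
  by move=> x xL i Ei; apply: (sub i Ei).
have [n hn] := hU i Ei.
have [|//|short] := @sub_or_short_union _ (size L) (product e L) _ hn.
  by move=> e' M rM _; apply: product_setI.
rewrite (_ : _ `&` _ = (product e L `&` U i) `&` \bigcap_(j in E) U j); last first.
  by rewrite -setIA (setIidr (bigcap_inf Ei)).
apply: short_union_setI short _ => e1 L1 rL1 sL1.
by apply: short_unionS (ih L1 e1 _ rL1); lia.
Qed.

Lemma short_union_bigcap (I : Type) (E : set I) (U : I -> set G) : E !=set0 ->
  (forall i, E i -> exists n, short_union n (U i)) ->
  exists n, short_union n (\bigcap_(i in E) U i).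
Proof.
move=> [i Ei] hU; have [n hn] := hU i Ei; exists n.
rewrite -(setIidr (bigcap_inf Ei)); apply: short_union_setI hn _ => e L rL sL.
exact: short_unionS (product_bigcap _ rL hU).
Qed.

(** * Translation between ME-products and lists of factors *)

Lemma ord_product n (f : 'I_n -> G) (H : 'I_n -> set G) :
  (forall i, infinite_maximal_elementary (H i)) ->
  exists e L, factors L /\
    [set \prod_(i < n) (f i * g i) | g in [set g : 'I_n -> G | forall i, H i (g i)]]
      = product e L.
Proof.
elim: n f H => [|n ih] f H hH.
  exists 1, [::]; split=> //; apply/seteqP; split=> x /=.
    by move=> [g _ <-]; rewrite big_ord0.
  by move=> ->; exists (fun=> 1); rewrite ?big_ord0 // => -[].
have [e [L [fL LE]]] := ih (fun i => f (lift ord0 i)) (fun i => H (lift ord0 i))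
  (fun i => hH _).
(* Coefficients move one place: each [f i] after the first is paired with the preceding subgroup,
   and the last pair ends in 1. *)
exists (f ord0), ((H ord0, e) :: L); split; first by split.
rewrite product_cons -LE; apply/seteqP; split=> x /=.
  move=> [g gH <-]; rewrite big_ord_recl.
  exists (g ord0), (\prod_(i < n) (f (lift ord0 i) * g (lift ord0 i))); split=> //.
  by exists (fun i => g (lift ord0 i)).
move=> [h [_ [hH0 [g gH <-] ->]]].
exists (fun i => if unlift ord0 i is Some j then g j else h).
  by move=> i /=; case: unliftP => [j|] ->.
rewrite big_ord_recl unlift_none; congr (_ * _).
by apply: eq_bigr => i _; rewrite liftK.
Qed.

Lemma ME_product_short_union P : ME_product P -> exists n, short_union n P.
Proof.
move=> [[n [f [H [hH ->]]]]|[g ->]]; last first.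
  by exists 1%N; apply: (@short_union1 _ g [::]).
(* Zero factors mean the empty set here, whereas the empty list of pairs gives a singleton. *)
case: n f H hH => [|n] f H hH; first by exists 0%N; apply: short_union0.
have [e [L [/(factors_reduce e)[e' [L' [rL' _ LE']]] LE]]] := ord_product f hH.
exists (size L').+1; rewrite /ME_product_set /= LE LE'; exact: short_union1.
Qed.

Lemma product_cons_ord e H g L : factors ((H, g) :: L) ->
  exists n (f : 'I_n.+1 -> G) (K : 'I_n.+1 -> set G),
    (forall i, infinite_maximal_elementary (K i)) /\
    product e ((H, g) :: L) =
      [set \prod_(i < n.+1) (f i * k i) | k in [set k | forall i, K i (k i)]].
Proof.
elim: L e H g => [|[K f'] L ih] e H g [mH fL].
  (* An ME-product has no trailing coefficient, so the last one moves across: H g = g (g^-1 H g). *)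
  exists 0%N, (fun=> e * g), (fun=> conj_set g^-1 H); split=> [i|].
    exact: infinite_maximal_elementary_conj.
  apply/seteqP; split=> x /=.
    move=> [h [_ [hH _ -> ->]]]; exists (fun=> h ^ g).
      by move=> _; rewrite /conj_set /= -conjgM mulgV conjg1.
    by rewrite big_ord_recl big_ord0 conjgE; gsimp.
  move=> [k kH <-]; have k0 : H (k ord0 ^ g^-1) by exact: kH ord0.
  exists (k ord0 ^ g^-1), g; split=> //.
  by rewrite big_ord_recl big_ord0 conjgE; gsimp.
have [n [f [M [hM LE]]]] := ih g K f' fL.
exists n.+1, (fun i => if unlift ord0 i is Some j then f j else e),
  (fun i => if unlift ord0 i is Some j then M j else H); split=> [i|].
  by case: unliftP.
rewrite product_cons LE; apply/seteqP; split=> x /=.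
  move=> [h [_ [hH [k kM <-] ->]]].
  exists (fun i => if unlift ord0 i is Some j then k j else h).
    by move=> i; case: unliftP.
  rewrite big_ord_recl unlift_none; congr (_ * _).
  by apply: eq_bigr => i _; rewrite liftK.
move=> [k kM <-].
exists (k ord0), (\prod_(i < n.+1) (f i * k (lift ord0 i))); split.
- by have := kM ord0; rewrite unlift_none.
- by exists (fun i => k (lift ord0 i)) => // i; have := kM (lift ord0 i); rewrite liftK.
rewrite [LHS]big_ord_recl unlift_none; congr (_ * _).
by apply: eq_bigr => i _; rewrite liftK.
Qed.

Lemma short_union_finite_union n S : short_union n S -> finite_union_ME_products S.
Proof.
elim=> [|e L rL _|S1 S2 _ [F1 [f1 h1 ->]] _ [F2 [f2 h2 ->]]].
- by exists set0; split=> //; rewrite bigcup_set0.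
- exists [set product e L]; split; [exact: finite_set1| |by rewrite bigcup_set1].
  move=> _ ->; case: L rL => [|[H g] L] rL; first by right; exists e.
  have [m [f [K [hK ->]]]] := product_cons_ord e (reduced_factors rL).
  by left; exists m.+1, f, K; split.
- exists (F1 `|` F2); split; [by rewrite finite_setU| |by rewrite bigcup_setU].
  by move=> P [/h1|/h2].
Qed.

Lemma finite_union_short_union S : finite_union_ME_products S ->
  exists n, short_union n S.
Proof.
move=> [F [/finite_seqP[s ->] hF ->]].
have [||n hn] := @seq_uniform_bound _ s (fun P n => short_union n P).
- by move=> P m n mn; apply: short_unionS.
- by move=> P Ps; apply/ME_product_short_union/hF.
exists n; rewrite (_ : \bigcup_(P in _) P =
  [set x | exists P, [/\ P \in s, setT P & P x]]).
  by apply: short_union_seq => P Ps _; apply: hn.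
by apply/seteqP; split=> x; [move=> [P Ps Px]|move=> [P [Ps _ Px]]]; exists P.
Qed.

End HyperbolicNorm.

Local Close Scope group_scope.

Theorem theorem3 (G : groupType) (hG : hyperbolic_group G)
    (I : Type) (D : set I) (U : I -> set G) (D_neq0 : D !=set0)
    (hU : forall i : I, D i -> finite_union_ME_products (U i)) :
  finite_union_ME_products (\bigcap_(i in D) U i).
Proof.
have [len [delta hN]] := hyperbolic_group_norm hG.
have hU' i : D i -> exists n, short_union len n (U i).
  by move=> /hU; apply: finite_union_short_union.
have [n hn] := short_union_bigcap hN D_neq0 hU'.
exact: short_union_finite_union hn.
Qed.
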